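(* Let $A,W\in\mathbb{C}^{n\times n}$ with $\mathrm{rk}(A)=r$, $\mathrm{rk}(W)=s$ and $k=\mathrm{Ind}(AW)$ be written as $$A=U\begin{bmatrix}\Sigma_A A_1&\Sigma_A A_2\\0&0\end{bmatrix}V^*,\qquad W=V\begin{bmatrix}\Sigma_W W_1&\Sigma_W W_2\\0&0\end{bmatrix}U^*,$$ where $U,V\in\mathbb{C}^{n\times n}$ are unitary, $\Sigma_A\in\mathbb{C}^{r\times r}$ and $\Sigma_W\in\mathbb{C}^{s\times s}$ are diagonal positive definite matrices, and the blocks $A_1\in\mathbb{C}^{r\times s}$, $A_2\in\mathbb{C}^{r\times(n-s)}$, $W_1\in\mathbb{C}^{s\times r}$, $W_2\in\mathbb{C}^{s\times(n-r)}$ satisfy $A_1A_1^*+A_2A_2^*=I_r$ and $W_1W_1^*+W_2W_2^*=I_s$. Then $$A^{\mathrm{cEP},W}=U\begin{bmatrix}(\Sigma_A A_1)^{\mathrm{cEP},(\Sigma_W W_1)}&0\\0&0\end{bmatrix}V^*.$$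
   Context: $R(M)$, $M^*$, $\mathrm{rk}(M)$, $M^\dagger$ denote the range, conjugate transpose, rank and Moore-Penrose inverse of a complex matrix $M$; $P_M:=MM^\dagger$. $\mathrm{Ind}(M)$ is the smallest nonnegative integer $j$ with $\mathrm{rk}(M^{j+1})=\mathrm{rk}(M^j)$. For $C\in\mathbb{C}^{p\times q}$ and $D\in\mathbb{C}^{q\times p}$, the $D$-weighted core-EP inverse $C^{\mathrm{cEP},D}\in\mathbb{C}^{p\times q}$ is the unique matrix $X$ satisfying $DCDX=P_{(DC)^{l}}$ and $R(X)\subset R((CD)^{l})$, where $l=\max\{\mathrm{Ind}(CD),\mathrm{Ind}(DC)\}$. *)

(* Defs.v *)
From HB Require Import structures.
From mathcomp Require Import all_boot all_order all_algebra.

Set Implicit Arguments.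
Unset Strict Implicit.
Unset Printing Implicit Defensive.

Import Order.TTheory GRing.Theory Num.Theory.
Local Open Scope ring_scope.
Local Open Scope sesquilinear_scope.

(* R(X) \subset R(M) for column spaces; the %MS operations act on row spaces. *)
Definition range_sub {F : fieldType} {m n p : nat}
    (X : 'M[F]_(m, n)) (M : 'M[F]_(m, p)) : bool := (X^T <= M^T)%MS.

Section Index.
Variables (F : fieldType) (n : nat).
Implicit Types (M : 'M[F]_n).

Lemma mxrank_expS M j : (\rank (M ^+ j.+1) <= \rank (M ^+ j))%N.
Proof. by rewrite exprSr mxrankM_maxl. Qed.

Lemma mxindex_subproof M : exists j, \rank (M ^+ j.+1) == \rank (M ^+ j).
Proof.
suff H r j : (\rank (M ^+ j) <= r)%N ->
    exists j, \rank (M ^+ j.+1) == \rank (M ^+ j) by exact: (H _ 0%N (leqnn _)).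
elim: r j => [|r IH] j le_r.
  by exists j; rewrite eqn_leq mxrank_expS (leq_trans le_r).
have [eq_j|neq_j] := eqVneq (\rank (M ^+ j.+1)) (\rank (M ^+ j)).
  by exists j; rewrite eq_j.
apply: (IH j.+1); rewrite -ltnS (leq_trans _ le_r) //.
by rewrite ltn_neqAle neq_j mxrank_expS.
Qed.

Definition mxindex M : nat := ex_minn (mxindex_subproof M).

Lemma mxindex_stable M l :
  (mxindex M <= l)%N -> exists Z : 'M_n, M ^+ l = M ^+ l.+1 *m Z.
Proof.
have [Z0 EZ0] : exists Z : 'M_n, M ^+ (mxindex M) = M ^+ (mxindex M).+1 *m Z.
  rewrite /mxindex; case: ex_minnP => j /eqP rj _.
  have sub : ((M ^+ j.+1)^T <= (M ^+ j)^T)%MS.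
    by rewrite exprSr trmx_mul submxMl.
  have := mxrank_leqif_sup sub; rewrite !mxrank_tr => -[_].
  rewrite rj eqxx => /esym/submxP[D /(congr1 trmx)].
  by rewrite trmxK trmx_mul trmxK => ->; exists D^T.
move=> /subnK <-; exists Z0.
by rewrite exprD EZ0 -addnS exprD -[in RHS]mulmxA -EZ0.
Qed.

Lemma mxindex_stable_add M l j :
  (mxindex M <= l)%N -> exists Z : 'M_n, M ^+ l = M ^+ (l + j) *m Z.
Proof.
elim: j => [|j IH] le_l; first by exists 1%:M; rewrite addn0 mulmx1.
have [Z1 E1] := IH le_l.
have [Z2 E2] := mxindex_stable (leq_trans le_l (leq_addr j l)).
by exists (Z2 *m Z1); rewrite mulmxA addnS -E2.
Qed.

Lemma mxindex_stable_addl M l j :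
  (mxindex M <= l)%N -> exists Z : 'M_n, M ^+ l = Z *m M ^+ (l + j).
Proof.
move=> /(mxindex_stable_add j)[Z EZ].
have sub : (M ^+ (l + j) <= M ^+ l)%MS by rewrite addnC exprD submxMl.
have := mxrank_leqif_sup sub => -[le]; rewrite eqn_leq le {1}EZ mxrankM_maxl.
by move=> /esym/submxP.
Qed.
End Index.

Section MoorePenrose.
Variable C : numClosedFieldType.

(* With this order 0 < z forces z to be real. *)
Definition posdefmx n (M : 'M[C]_n) : Prop :=
  M \is hermsymmx /\
  forall x : 'cV[C]_n, x != 0 -> 0 < (x^t* *m M *m x) 0 0.

Definition is_mpinv m n (M : 'M[C]_(m, n)) (X : 'M[C]_(n, m)) : bool :=
  [&& M *m X *m M == M, X *m M *m X == X,
      (M *m X)^t* == M *m X & (X *m M)^t* == X *m M].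

Lemma ctmx_mul m n p (A : 'M[C]_(m, n)) (B : 'M[C]_(n, p)) :
  (A *m B)^t* = B^t* *m A^t*.
Proof. by rewrite trmx_mul map_mxM. Qed.

Lemma gram_unit m n (B : 'M[C]_(m, n)) : row_free B -> B *m B^t* \in unitmx.
Proof.
move=> fB; rewrite -row_free_unit -kermx_eq0; apply/eqP/row_matrixP=> i.
set v := row i _; rewrite row0.
have v0 : v *m (B *m B^t*) = 0 by rewrite /v -row_mul mulmx_ker row0.
have: v *m B == 0.
  apply/negPn/negP => /dotmx_is_dotmx; rewrite dotmxE ctmx_mul -mulmxA (mulmxA B).
  by rewrite mulmxA v0 mul0mx mxE ltxx.
by rewrite mulmx_free_eq0 // => /eqP.
Qed.

Lemma mpinv_subproof m n (M : 'M[C]_(m, n)) : exists X, is_mpinv M X.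
Proof.
have: M = col_base M *m row_base M by rewrite mulmx_base.
move: (row_base_free M) (col_base_full M).
move: (row_base M) (col_base M); move: (\rank M) => r B D fB fD EM.
have uB : B *m B^t* \in unitmx by exact: gram_unit.
have uD : D^t* *m D \in unitmx.
  rewrite -{2}[D]trmxCK; apply: gram_unit.
  by rewrite /row_free mxrank_map mxrank_tr.
pose GB := invmx (B *m B^t*); pose GD := invmx (D^t* *m D).
have cB : GB^t* = GB.
  rewrite /GB trmx_inv map_invmx; congr invmx.
  by rewrite ctmx_mul trmxCK.
have cD : GD^t* = GD.
  rewrite /GD trmx_inv map_invmx; congr invmx.
  by rewrite ctmx_mul trmxCK.
pose X := B^t* *m GB *m GD *m D^t*.
exists X.
have EMX : M *m X = D *m GD *m D^t*.
  by rewrite /X EM -!mulmxA (mulmxA B) (mulmxA (B *m _) GB) mulmxV // mul1mx.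
have EXM : X *m M = B^t* *m GB *m B.
  by rewrite /X EM -!mulmxA (mulmxA _ D) (mulmxA GD) mulVmx // mul1mx.
apply/and4P; split; apply/eqP.
- by rewrite EMX EM -!mulmxA (mulmxA _ D) (mulmxA GD) mulVmx // mul1mx.
- by rewrite EXM /X -!mulmxA (mulmxA B) (mulmxA (B *m _) GB) mulmxV // mul1mx.
- by rewrite EMX !ctmx_mul trmxCK cD mulmxA.
- by rewrite EXM !ctmx_mul trmxCK cB mulmxA.
Qed.

Definition mpinv m n (M : 'M[C]_(m, n)) : 'M[C]_(n, m) :=
  xchoose (mpinv_subproof M).

Lemma mpinvP m n (M : 'M[C]_(m, n)) : is_mpinv M (mpinv M).
Proof. exact: xchooseP. Qed.

Lemma mpinv_unique m n (M : 'M[C]_(m, n)) X Y :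
  is_mpinv M X -> is_mpinv M Y -> X = Y.
Proof.
move=> /and4P[/eqP X1 /eqP X2 /eqP X3 /eqP X4].
move=> /and4P[/eqP Y1 /eqP Y2 /eqP Y3 /eqP Y4].
have EL : M *m X = M *m Y.
  by rewrite -X3 -{1}Y1 -(mulmxA (M *m Y)) ctmx_mul X3 Y3 mulmxA X1.
have ER : X *m M = Y *m M.
  by rewrite -X4 -{1}Y1 -(mulmxA M) mulmxA ctmx_mul X4 Y4 -mulmxA (mulmxA M) X1.
by rewrite -X2 ER -mulmxA EL mulmxA Y2.
Qed.

Definition projmx m n (M : 'M[C]_(m, n)) : 'M[C]_m := M *m mpinv M.

Section CoreEP.
Variables p q : nat.
Implicit Types (X A : 'M[C]_(p, q)) (D : 'M[C]_(q, p)).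

Definition wcep_index A D : nat :=
  maxn (mxindex (A *m D)) (mxindex (D *m A)).

Definition is_wcep A D X : bool :=
  let l := wcep_index A D in
  (D *m A *m D *m X == projmx ((D *m A) ^+ l)) && range_sub X ((A *m D) ^+ l).

Lemma expmx_swap A D j : A *m (D *m A) ^+ j = (A *m D) ^+ j *m A.
Proof.
elim: j => [|j IH]; first by rewrite mulmx1 mul1mx.
by rewrite !exprS -!mulmxE -!mulmxA IH !mulmxA.
Qed.

Lemma wcep_subproof A D : exists X, is_wcep A D X.
Proof.
rewrite /is_wcep /=; set l := wcep_index A D.
have [Z EZ] := mxindex_stable_add 2 (leq_maxr _ _ : (mxindex (D *m A) <= l)%N).
pose Y := A *m (D *m A) ^+ l *m Z *m mpinv ((D *m A) ^+ l).
exists Y; apply/andP; split; last first.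
  by rewrite /range_sub /Y expmx_swap -!mulmxA trmx_mul submxMl.
apply/eqP; rewrite /Y /projmx {3}EZ addnC 2!exprS -!mulmxE.
by rewrite !mulmxA.
Qed.

Definition wcep A D : 'M[C]_(p, q) := xchoose (wcep_subproof A D).

Lemma wcepP A D : is_wcep A D (wcep A D).
Proof. exact: xchooseP. Qed.

End CoreEP.

Lemma wcep_unique p q (A : 'M[C]_(p, q)) (D : 'M[C]_(q, p)) X Y :
  is_wcep A D X -> is_wcep A D Y -> X = Y.
Proof.
rewrite /is_wcep /=; set l := wcep_index A D.
move=> /andP[/eqP EX sX] /andP[/eqP EY sY].
have : range_sub (X - Y) ((A *m D) ^+ l).
  by rewrite /range_sub linearB /= addmx_sub // eqmx_opp.
move=> /submxP[T /(congr1 trmx)]; rewrite trmxK trmx_mul trmxK => ET.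
have [Z EZ] := mxindex_stable_addl 2 (leq_maxl _ _ : (mxindex (A *m D) <= l)%N).
apply/eqP; rewrite -subr_eq0 ET; apply/eqP.
rewrite EZ addnC exprD -mulmxE -!mulmxA -ET.
have := EX; rewrite -EY => /eqP; rewrite -subr_eq0 -mulmxBr -!mulmxA => /eqP ->.
by rewrite !mulmx0.
Qed.

End MoorePenrose.

Lemma rank_split (F : fieldType) n (A : 'M[F]_n) r :
  \rank A = r -> (r + (n - r))%N = n.
Proof. by move=> <-; rewrite subnKC // rank_leq_row. Qed.

(* Main.v *)
Require Import Defs.
From HB Require Import structures.
From mathcomp Require Import all_boot all_order all_algebra.
From mathcomp Require Import complex reals.

Set Implicit Arguments.
Unset Strict Implicit.
Unset Printing Implicit Defensive.

Import Order.TTheory GRing.Theory Num.Theory.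
Local Open Scope ring_scope.
Local Open Scope sesquilinear_scope.
Local Open Scope complex_scope.

(** The equation and the range condition that define the weighted core-EP
    inverse are compatible with a change of orthonormal bases, because a unitary
    matrix carries orthogonal projectors to orthogonal projectors
    ([wcep_unitary]).  So U and V can be removed, and what is left is a statement
    on the block matrices A = [A1 A2; 0 0] and W = [W1 W2; 0 0], where the blocks
    now include the diagonal factors.

    The difficulty is that the exponent l in the definition is the maximum of
    two indices, and this maximum need not be the same for the pair (A, W) and
    for the pair (A1, W1).  It can however be replaced by any larger exponent:
    beyond the index the range of a power no longer changes, and both the
    orthogonal projector and the range condition see that range only
    ([wcep_spec_ge], [wcep_eq]).  So one exponent can serve both pairs.

    With M = W1 A1 one has (W A)^(j+1) = [M^(j+1)  M^j (W1 A2); 0 0].  Once j is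
    beyond the index of M, the second block has its range inside R(M^(j+1)), so
    that the projector onto R((W A)^(j+1)) is [P 0; 0 0] with P the projector
    onto R(M^(j+1)) ([projmx_block]).  The block matrix built from the inverse X
    of the pair (A1, W1) then satisfies the defining conditions because X does,
    and uniqueness concludes ([wcep_block]). *)

(** * Ranges and orthogonal projectors *)

Lemma range_subP (F : fieldType) (m n p : nat) (X : 'M[F]_(m, n))
    (M : 'M[F]_(m, p)) : reflect (exists T, X = M *m T) (range_sub X M).
Proof.
apply: (iffP submxP) => [[T]|[T ->]].
  by move/(congr1 trmx); rewrite trmx_mul !trmxK => ->; exists T^T.
by exists T^T; rewrite trmx_mul.
Qed.

Section Projector.
Variable C : numClosedFieldType.

Lemma projmx_herm m n (M : 'M[C]_(m, n)) : (projmx M)^t* = projmx M.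
Proof. by case/and4P: (mpinvP M) => _ _ /eqP. Qed.

Lemma projmx_id m n (M : 'M[C]_(m, n)) : projmx M *m M = M.
Proof. by case/and4P: (mpinvP M) => /eqP. Qed.

(** Two such matrices absorb each other, P Q = Q and Q P = P, and taking the
    adjoint of the first equation gives Q P = Q. *)
Lemma projmx_unique m n (M : 'M[C]_(m, n)) (P : 'M[C]_m) Y :
  P^t* = P -> P *m M = M -> P = M *m Y -> projmx M = P.
Proof.
move=> hP PM EP.
have PQ : P *m projmx M = projmx M by rewrite /projmx mulmxA PM.
have QP : projmx M *m P = P by rewrite EP mulmxA projmx_id.
by rewrite -[LHS]projmx_herm -PQ ctmx_mul projmx_herm hP QP.
Qed.

Lemma projmx_range m n p (M : 'M[C]_(m, n)) (N : 'M[C]_(m, p)) :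
  range_sub M N -> range_sub N M -> projmx M = projmx N.
Proof.
move=> /range_subP[S ES] /range_subP[T ET].
apply: (@projmx_unique _ _ _ _ (T *m mpinv N)); first exact: projmx_herm.
  by rewrite ES mulmxA projmx_id.
by rewrite mulmxA -ET.
Qed.

Lemma mulmx_unitary m n p q k (U : 'M[C]_(m, n)) (A : 'M[C]_(n, p))
    (V : 'M[C]_p) (B : 'M[C]_(p, q)) (Z : 'M[C]_(q, k)) : V \is unitarymx ->
  U *m A *m V^t* *m (V *m B *m Z) = U *m (A *m B) *m Z.
Proof.
move=> /unitarymxP /mulmx1C VV.
by rewrite -!mulmxA (mulmxA _ V) VV mul1mx.
Qed.

Lemma projmx_unitary n (V M : 'M[C]_n) : V \is unitarymx ->
  projmx (V *m M *m V^t*) = V *m projmx M *m V^t*.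
Proof.
move=> uV.
apply: (@projmx_unique _ _ _ _ (V *m mpinv M *m V^t*)).
- by rewrite 2!ctmx_mul trmxCK projmx_herm mulmxA.
- by rewrite mulmx_unitary // projmx_id.
- by rewrite mulmx_unitary.
Qed.

(** The columns of N add nothing to the range of M, and the zero rows only
    embed that range in a larger space. *)
Lemma projmx_block m m' n n' (M : 'M[C]_(m, n)) (N : 'M[C]_(m, n')) :
  range_sub N M ->
  projmx (block_mx M N 0 0) = block_mx (projmx M) 0 0 0 :> 'M_(m + m').
Proof.
move=> /range_subP[T ET].
apply: (@projmx_unique _ _ _ _ (block_mx (mpinv M) 0 0 0)).
- by rewrite tr_block_mx map_block_mx projmx_herm !linear0 !map_mx0.
- rewrite mulmx_block !(mulmx0, mul0mx, addr0) projmx_id.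
  by rewrite ET mulmxA projmx_id.
- by rewrite mulmx_block !(mulmx0, mul0mx, addr0).
Qed.

End Projector.

(** * The exponent in the weighted core-EP inverse *)

Lemma range_sub_mxindex (F : fieldType) n (M : 'M[F]_n) i j :
  (mxindex M <= i)%N -> range_sub (M ^+ i) (M ^+ j).
Proof.
move=> le_i; have [Z EZ] := mxindex_stable_add j le_i.
apply/range_subP; exists (M ^+ i *m Z).
by rewrite {1}EZ addnC exprD mulmxA.
Qed.

Section Exponent.
Variables (C : numClosedFieldType) (p q : nat).
Implicit Types (A X : 'M[C]_(p, q)) (D : 'M[C]_(q, p)).

(** The exponent is a parameter because the smallest admissible one changes
    when a pair of matrices is bordered by blocks. *)
Definition wcep_spec A D (l : nat) X : Prop :=
  D *m A *m D *m X = projmx ((D *m A) ^+ l) /\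
  exists T, X = (A *m D) ^+ l *m T.

(** Both conditions see only the ranges of the two powers, which no longer
    change once the exponent has reached the indices. *)
Lemma wcep_spec_exponent A D X l l' :
  (wcep_index A D <= l)%N -> (wcep_index A D <= l')%N ->
  wcep_spec A D l X -> wcep_spec A D l' X.
Proof.
rewrite /wcep_index !geq_max => /andP[l1 l2] /andP[l1' l2'] [E [T ET]]; split.
  by rewrite E; apply: projmx_range; apply: range_sub_mxindex.
have /range_subP[S ES] := range_sub_mxindex l' l1.
by exists (S *m T); rewrite mulmxA -ES.
Qed.

Lemma wcep_spec_ge A D l :
  (wcep_index A D <= l)%N -> wcep_spec A D l (wcep A D).
Proof.
move=> le_l; apply: (wcep_spec_exponent (leqnn _) le_l).
by case/andP: (wcepP A D) => /eqP E /range_subP.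
Qed.

Lemma wcep_eq A D X l :
  (wcep_index A D <= l)%N -> wcep_spec A D l X -> wcep A D = X.
Proof.
move=> le_l /(wcep_spec_exponent le_l (leqnn _))[E rX].
apply: wcep_unique (wcepP A D) _.
by apply/andP; split; [apply/eqP | apply/range_subP].
Qed.

End Exponent.

(** * Unitary equivalence and block form *)

Section Reduction.
Variable C : numClosedFieldType.

Lemma expmx_unitary n (V M : 'M[C]_n) j : V \is unitarymx ->
  (V *m M *m V^t*) ^+ j = V *m M ^+ j *m V^t*.
Proof.
move=> uV; elim: j => [|j IH].
  by rewrite !expr0 mulmx1; apply/esym/unitarymxP.
by rewrite !exprS IH -!mulmxE mulmx_unitary.
Qed.

Lemma wcep_unitary p q (U : 'M[C]_p) (V : 'M[C]_q)
    (A : 'M[C]_(p, q)) (W : 'M[C]_(q, p)) :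
  U \is unitarymx -> V \is unitarymx ->
  wcep (U *m A *m V^t*) (V *m W *m U^t*) = U *m wcep A W *m V^t*.
Proof.
move=> uU uV; set A' := U *m A *m _; set W' := V *m W *m _.
have EAW : A' *m W' = U *m (A *m W) *m U^t* by rewrite mulmx_unitary.
have EWA : W' *m A' = V *m (W *m A) *m V^t* by rewrite mulmx_unitary.
pose l := maxn (wcep_index A W) (wcep_index A' W').
have [E [T ET]] : wcep_spec A W l (wcep A W).
  by apply: wcep_spec_ge; rewrite leq_maxl.
apply: (@wcep_eq _ _ _ _ _ _ l); first by rewrite leq_maxr.
split.
  by rewrite EWA expmx_unitary // projmx_unitary // -E !mulmx_unitary.
exists (U *m T *m V^t*).
by rewrite EAW expmx_unitary // mulmx_unitary // -ET.
Qed.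

Lemma expmx_block_row0 m m' (M : 'M[C]_m) (N : 'M[C]_(m, m')) j :
  block_mx M N 0 0 ^+ j.+1 = block_mx (M ^+ j.+1) (M ^+ j *m N) 0 0.
Proof.
elim: j => [|j IH]; first by rewrite !expr1 expr0 mul1mx.
rewrite exprS IH -mulmxE mulmx_block !(mulmx0, mul0mx, addr0).
by rewrite mulmxA !mulmxE -!exprS.
Qed.

Lemma wcep_block p p' q q' (A1 : 'M[C]_(p, q)) (A2 : 'M[C]_(p, q'))
    (W1 : 'M[C]_(q, p)) (W2 : 'M[C]_(q, p')) :
  wcep (block_mx A1 A2 0 0 : 'M_(p + p', q + q')) (block_mx W1 W2 0 0) =
  block_mx (wcep A1 W1) 0 0 0.
Proof.
set A := block_mx A1 _ _ _; set W := block_mx W1 _ _ _.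
have EAW : A *m W = block_mx (A1 *m W1) (A1 *m W2) 0 0.
  by rewrite mulmx_block !(mulmx0, mul0mx, addr0).
have EWA : W *m A = block_mx (W1 *m A1) (W1 *m A2) 0 0.
  by rewrite mulmx_block !(mulmx0, mul0mx, addr0).
(* The exponent is l.+1 so that already the l-th power of W1 *m A1, which
   appears in the upper right block, has reached the stable range. *)
pose l := maxn (wcep_index A1 W1) (wcep_index A W).
have [E [T ET]] : wcep_spec A1 W1 l.+1 (wcep A1 W1).
  by apply: wcep_spec_ge; rewrite leqW // leq_maxl.
apply: (@wcep_eq _ _ _ _ _ _ l.+1); first by rewrite leqW // leq_maxr.
split.
  rewrite EWA expmx_block_row0 projmx_block.
    by rewrite !mulmx_block !(mulmx0, mul0mx, addr0) E.
  have le_l : (mxindex (W1 *m A1) <= l)%N.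
    by rewrite (leq_trans _ (leq_maxl _ _)) // leq_maxr.
  have /range_subP[Z EZ] := range_sub_mxindex l.+1 le_l.
  by apply/range_subP; exists (Z *m (W1 *m A2)); rewrite {1}EZ !mulmxA.
exists (block_mx T 0 0 0).
by rewrite EAW expmx_block_row0 mulmx_block !(mulmx0, mul0mx, addr0) -ET.
Qed.

(** With the dimensions as separate variables, the casts of the theorem can be
    eliminated by substitution; this is impossible for n = r + (n - r). *)
Lemma wcep_unitary_block p q r r' s s' (ep : (r + r')%N = p)
    (eq : (s + s')%N = q) (U : 'M[C]_p) (V : 'M[C]_q)
    (A1 : 'M[C]_(r, s)) (A2 : 'M[C]_(r, s'))
    (W1 : 'M[C]_(s, r)) (W2 : 'M[C]_(s, r')) :
  U \is unitarymx -> V \is unitarymx ->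
  wcep (U *m castmx (ep, eq) (block_mx A1 A2 0 0) *m V^t*)
       (V *m castmx (eq, ep) (block_mx W1 W2 0 0) *m U^t*) =
  U *m castmx (ep, eq) (block_mx (wcep A1 W1) 0 0 0) *m V^t*.
Proof.
move=> uU uV; rewrite wcep_unitary //.
by case: _ / ep U uU; case: _ / eq V uV => *; rewrite !castmx_id wcep_block.
Qed.

End Reduction.

Theorem theorem5p3 (R : realType) (n r s k : nat) (A W : 'M[R[i]]_n)
  (rkA : \rank A = r) (rkW : \rank W = s) (indAW : k = mxindex (A *m W))
  (U V : 'M[R[i]]_n) (SA : 'M[R[i]]_r) (SW : 'M[R[i]]_s)
  (A1 : 'M[R[i]]_(r, s)) (A2 : 'M[R[i]]_(r, n - s))
  (W1 : 'M[R[i]]_(s, r)) (W2 : 'M[R[i]]_(s, n - r))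
  (unitaryU : U \is unitarymx) (unitaryV : V \is unitarymx)
  (diagSA : is_diag_mx SA) (posSA : posdefmx SA)
  (diagSW : is_diag_mx SW) (posSW : posdefmx SW)
  (A12 : A1 *m A1^t* + A2 *m A2^t* = 1%:M)
  (W12 : W1 *m W1^t* + W2 *m W2^t* = 1%:M)
  (defA : A = U *m castmx (rank_split rkA, rank_split rkW)
                     (block_mx (SA *m A1) (SA *m A2) 0 0) *m V^t*)
  (defW : W = V *m castmx (rank_split rkW, rank_split rkA)
                     (block_mx (SW *m W1) (SW *m W2) 0 0) *m U^t*) :
  wcep A W = U *m castmx (rank_split rkA, rank_split rkW)
                    (block_mx (wcep (SA *m A1) (SW *m W1)) 0 0 0) *m V^t*.
Proof.
have := wcep_unitary_block (rank_split rkA) (rank_split rkW)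
  (SA *m A1) (SA *m A2) (SW *m W1) (SW *m W2) unitaryU unitaryV.
by rewrite -defA -defW.
Qed.
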